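(* For every fixed integer $s\ge2$ and every real constant $C$, there are arbitrarily large multiples $n$ of $2s$ and $n$-vertex oriented graphs $D$ such that $$\sigma_{\mathrm{Ore}}^*(D)\ge\frac34n+C,$$ but $D$ has no $C_{2s}^{\mathrm{ad}}$-factor. More precisely, these $D$ can be chosen so that in addition $$\sigma_{\mathrm{Ore}}^*(D)\ge\begin{cases}\frac34n+\frac34\alpha(D)-2,& s=2,\\[1mm] \frac34n+\frac14\alpha(D)-\frac32,& s\ge3.\end{cases}$$
   Context: An oriented graph is a finite digraph obtained by assigning a direction to each edge of a simple graph. $A(D)$ is the arc set of $D$. $\alpha(D)$ is the independence number of the underlying undirected graph of $D$. $d_D^*(v):=\max\{d_D^+(v),d_D^-(v)\}$ and $$\sigma_{\mathrm{Ore}}^*(D):=\min\{d_D^*(x)+d_D^*(y): x\ne y,\ xy,yx\notin A(D)\},$$ with $\sigma_{\mathrm{Ore}}^*(D)=\infty$ if the underlying graph of $D$ is complete. $C_{2s}^{\mathrm{ad}}$ is the anti-directed cycle on $2s$ vertices: the orientation of $C_{2s}$ in which edge directions alternate, i.e. every vertex is either a source (out-degree 2) or a sink (in-degree 2) of the cycle. An $H$-factor of $D$ is a set of pairwise vertex-disjoint (not necessarily induced) copies of $H$ in $D$ covering $V(D)$. *)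

(* Defs.v *)
From HB Require Import structures.
From mathcomp Require Import all_boot all_order all_algebra.
From mathcomp Require Import reals constructive_ereal.
Set Implicit Arguments.
Unset Strict Implicit.
Unset Printing Implicit Defensive.

Record oriented_graph (V : finType) := OrientedGraph {
  arc :> rel V;
  arc_irrefl : irreflexive arc;
  arc_asym : forall x y, arc x y -> ~~ arc y x }.

Section OrientedGraphs.
Variables (V : finType) (D : oriented_graph V).

Definition adj (x y : V) : bool := D x y || D y x.

Definition independent (A : {set V}) : bool :=
  [forall x in A, forall y in A, ~~ adj x y].

Definition alpha : nat := \max_(A : {set V} | independent A) #|A|.

Definition outdeg (v : V) : nat := #|[set w | D v w]|.
Definition indeg (v : V) : nat := #|[set w | D w v]|.
Definition dstar (v : V) : nat := maxn (outdeg v) (indeg v).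

(* The value is +oo when the underlying graph is complete. *)
Definition sigma_Ore_star (R : realType) : \bar R :=
  \big[Order.min/+oo%E]_(p : V * V | (p.1 != p.2) && ~~ adj p.1 p.2)
    ((dstar p.1 + dstar p.2)%:R%:E)%E.

End OrientedGraphs.

(* A copy of H in D (as a not necessarily induced subgraph) is given by an
   arc-preserving injection of the vertices of H into those of D. *)
Definition is_copy (W V : finType) (H : oriented_graph W)
    (D : oriented_graph V) (f : {ffun W -> V}) : Prop :=
  injective f /\ (forall x y, H x y -> D (f x) (f y)).

Definition is_factor (W V : finType) (H : oriented_graph W)
    (D : oriented_graph V) (F : {set {ffun W -> V}}) : Prop :=
  [/\ forall f, f \in F -> is_copy H D f,
      forall f g, f \in F -> g \in F -> f != g -> [disjoint codom f & codom g]
    & forall v, exists2 f, f \in F & v \in codom f].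

Definition has_factor (W V : finType) (H : oriented_graph W)
    (D : oriented_graph V) : Prop :=
  exists F : {set {ffun W -> V}}, is_factor H D F.

(* The cycle 0, 1, ..., 2s-1 (indices mod 2s) with the even vertices as its
   sources and the odd ones as its sinks. *)
Definition ad_cycle_arc (s : nat) (i j : 'I_(2 * s)) : bool :=
  ~~ odd i && ((j == i.+1 %% (2 * s) :> nat) || (i == j.+1 %% (2 * s) :> nat)).

Lemma ad_cycle_arc_odd (s : nat) (i j : 'I_(2 * s)) :
  ad_cycle_arc i j -> odd j.
Proof.
have odd_mod k : odd (k %% (2 * s)) = odd k.
  by rewrite {2}(divn_eq k (2 * s)) oddD !oddM andbF.
case/andP=> oi /orP[] /eqP h; first by rewrite h odd_mod /= oi.
by move: oi; rewrite h odd_mod /= negbK.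
Qed.

Lemma ad_cycle_irrefl (s : nat) : irreflexive (@ad_cycle_arc s).
Proof.
move=> i; apply/negP => h; have := ad_cycle_arc_odd h.
by case/andP: h => /negbTE ->.
Qed.

Lemma ad_cycle_asym (s : nat) (i j : 'I_(2 * s)) :
  ad_cycle_arc i j -> ~~ ad_cycle_arc j i.
Proof. by move=> h; rewrite /ad_cycle_arc (ad_cycle_arc_odd h). Qed.

Definition ad_cycle (s : nat) : oriented_graph 'I_(2 * s) :=
  OrientedGraph (@ad_cycle_irrefl s) (@ad_cycle_asym s).

(* Main.v *)
Require Import Defs.
From HB Require Import structures.
From mathcomp Require Import all_boot all_order all_algebra.
From mathcomp Require Import reals constructive_ereal.
From mathcomp Require Import zify lra.
Import Order.TTheory GRing.Theory Num.Theory.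
Local Open Scope ring_scope.

(** Let an apex [v] dominate an independent set [X], let [X] dominate a regular
    tournament [Z], and leave [v] and [Z] non-adjacent.  An anti-directed cycle
    through [v] has [v] as a source (nothing enters [v]), and the next source
    along the cycle sends an arc to a vertex of [X]; but only [v] does so, hence
    [v] lies on no such cycle.  The non-adjacent pairs lie inside [X] or join
    [v] to [Z], so their degree sums are at least [2|Z|] and
    [2|X| + (|Z| - 1)/2], and the choice [|X| = n/3] meets both bounds. *)

Section ApexGraph.
Variables a m : nat.

(** [None] is the apex $v$, [inl] marks $X$ and [inr] marks $Z$. *)
Notation vertex := (option ('I_a + 'I_(2 * m).+1)).

(** The rotational tournament: the difference is taken modulo $2m+1$. *)
Definition rot_arc (i j : 'I_(2 * m).+1) : bool := (0 < (j - i)%R <= m)%N.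

Lemma rot_arcxx i : rot_arc i i = false.
Proof. by rewrite /rot_arc subrr. Qed.

(** For a nonzero residue $d$ modulo $2m+1$, exactly one of $d$ and $-d$ lies in $\{1,\dots,m\}$. *)
Lemma rot_arcC i j : i != j -> rot_arc j i = ~~ rot_arc i j.
Proof.
rewrite /rot_arc -subr_eq0 -(opprB i j); move: (i - j)%R => d.
rewrite -val_eqE /= => d0; have := ltn_ord d.
rewrite modn_small; lia.
Qed.

Lemma card_rot_in j : #|[set i | rot_arc i j]| = m.
Proof.
have -> : [set i | rot_arc i j] =
    (fun k => j - k) @: [set k : 'I_(2 * m).+1 | (0 < k <= m)%N].
  apply/setP => i; apply/idP/imsetP => [|[k]].
    by rewrite inE => ij; exists (j - i); rewrite ?inE // subKr.
  by rewrite !inE => k_m ->; rewrite /rot_arc subKr.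
rewrite card_imset; last by move=> x y /addrI /oppr_inj.
(* The shift lists the differences $1,\dots,m$; since $m<2m+1$, [inord] never takes its default
   value. *)
have inj : injective (fun k : 'I_m => inord k.+1 : 'I_(2 * m).+1).
  move=> x y /(congr1 val); rewrite /= !inordK; last 2 first.
  - by have := ltn_ord y; lia.
  - by have := ltn_ord x; lia.
  by move=> [] /val_inj.
rewrite -[RHS](card_ord m) -cardsT -(card_imset _ inj); apply: eq_card => k.
rewrite inE; apply/idP/imsetP => [k_m|[l _ ->]].
  have lt_k : (k.-1 < m)%N by lia.
  by exists (Ordinal lt_k) => //; apply: val_inj; rewrite /= inordK; lia.
by case: l => l lm; rewrite inordK /=; lia.
Qed.

Definition apex_arc (x y : vertex) : bool :=
  match x, y with
  | None, Some (inl _) => true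
  | Some (inl _), Some (inr _) => true
  | Some (inr i), Some (inr j) => rot_arc i j
  | _, _ => false
  end.

Lemma apex_arc_irrefl : irreflexive apex_arc.
Proof. by case=> [[i|i]|] //=; apply: rot_arcxx. Qed.

Lemma apex_arc_asym x y : apex_arc x y -> ~~ apex_arc y x.
Proof.
case: x => [[i|i]|]; case: y => [[j|j]|] //=.
by have [<-|/rot_arcC ->] := eqVneq i j; rewrite ?rot_arcxx ?negbK.
Qed.

Definition apex_graph : oriented_graph vertex :=
  OrientedGraph apex_arc_irrefl apex_arc_asym.

Lemma card_apex_graph : #|{: vertex}| = (a + 2 * m + 2)%N.
Proof. by rewrite card_option card_sum !card_ord; lia. Qed.

Lemma dstar_apex : (a <= dstar apex_graph None)%N.
Proof.
apply: leq_trans (leq_maxl _ _).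
rewrite -[X in (X <= _)%N](card_ord a) -cardsT.
rewrite -(card_imset _ (inj_comp Some_inj (@inl_inj _ 'I_(2 * m).+1))).
by apply/subset_leq_card/subsetP => _ /imsetP[i _ ->]; rewrite inE.
Qed.

Lemma dstar_indep i : (2 * m + 1 <= dstar apex_graph (Some (inl i)))%N.
Proof.
apply: leq_trans (leq_maxl _ _).
rewrite addn1 -[X in (X <= _)%N](card_ord (2 * m).+1) -cardsT.
rewrite -(card_imset _ (inj_comp Some_inj (@inr_inj 'I_a _))).
by apply/subset_leq_card/subsetP => _ /imsetP[j _ ->]; rewrite inE.
Qed.

(** The in-degree is what counts here: all of $X$, plus $m$ in-neighbours inside $Z$. *)
Lemma dstar_tournament j : (a + m <= dstar apex_graph (Some (inr j)))%N.
Proof.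
apply: leq_trans (leq_maxr _ _).
pose L : {set vertex} := (Some \o inl) @: [set: 'I_a].
pose M : {set vertex} := (Some \o inr) @: [set i | rot_arc i j].
have cL : #|L| = a.
  by rewrite card_imset ?cardsT ?card_ord //; apply: inj_comp Some_inj inl_inj.
have cM : #|M| = m.
  by rewrite card_imset ?card_rot_in //; apply: inj_comp Some_inj inr_inj.
have LM0 : L :&: M = set0.
  by apply/setP => x; rewrite !inE; apply/andP => -[/imsetP[i _ ->] /imsetP[]].
have -> : (a + m = #|L :|: M|)%N by rewrite cardsU LM0 cards0 subn0 cL cM.
apply/subset_leq_card/subsetP => x; rewrite !inE => /orP[] /imsetP[i].
  by move=> _ ->.
by rewrite inE => ij ->.
Qed.

Lemma apex_Ore_pair x y : x != y -> ~~ adj apex_graph x y ->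
  (minn (4 * m + 2) (2 * a + m) <= dstar apex_graph x + dstar apex_graph y)%N.
Proof.
rewrite /adj; case: x => [[i|i]|]; case: y => [[j|j]|] //=.
- by move=> _ _; apply: leq_trans (leq_add (dstar_indep i) (dstar_indep j)); lia.
- rewrite (inj_eq Some_inj) (inj_eq inr_inj) => ij.
  by rewrite (rot_arcC _ _ ij) orbN.
- by move=> _ _; apply: leq_trans (leq_add (dstar_tournament i) dstar_apex); lia.
- by move=> _ _; apply: leq_trans (leq_add dstar_apex (dstar_tournament j)); lia.
Qed.

(** Every vertex of $X$ is adjacent to everything outside $X$, so an independent set meeting $X$
    lies in $X$. Any other contains at most the apex and one vertex of the tournament, whence $2\le
    a$. *)
Lemma alpha_apex : (2 <= a)%N -> (alpha apex_graph <= a)%N.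
Proof.
move=> a2; apply/bigmax_leqP => A /forallP indA.
have {}indA x y : x \in A -> y \in A -> ~~ adj apex_graph x y.
  by move=> xA yA; move/implyP/(_ xA)/forallP/(_ y)/implyP/(_ yA): (indA x).
have [i iA|noX] := pickP [pred i | Some (inl i) \in A].
  suff sA : A \subset (Some \o inl) @: [set: 'I_a].
    rewrite (leq_trans (subset_leq_card sA)) // (leq_trans (leq_imset_card _ _)) //.
    by rewrite cardsT card_ord.
  apply/subsetP => -[[j|j]|] yA; last 2 first.
  - by have := indA _ _ iA yA.
  - by have := indA _ _ iA yA.
  exact: (imset_f (Some \o inl)).
apply: leq_trans a2.
have [j jA|noZ] := pickP [pred j | Some (inr j) \in A].
  apply: (@leq_trans #|[set None; Some (inr j) : vertex]|); last first.
    by rewrite cards2.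
  apply/subset_leq_card/subsetP => -[[l|l]|] yA; rewrite !inE //.
    by have := noX l; rewrite /= yA.
  have [->|jl] := eqVneq l j; first by rewrite eqxx.
  by have := indA _ _ yA jA; rewrite /adj /= (rot_arcC _ _ jl) orbN.
apply: (@leq_trans #|[set None : vertex]|); last by rewrite cards1.
apply/subset_leq_card/subsetP => -[[l|l]|] yA; rewrite ?inE //.
  by have := noX l; rewrite /= yA.
by have := noZ l; rewrite /= yA.
Qed.

Lemma apex_no_factor s : (2 <= s)%N -> ~ has_factor (ad_cycle s) apex_graph.
Proof.
move=> s2 [F [copyF _ covF]]; have [f fF /codomP[i fi]] := covF None.
have [injf homf] := copyF f fF.
have mod_lt k : (k %% (2 * s) < 2 * s)%N by rewrite ltn_mod; lia.
pose i1 := Ordinal (mod_lt i.+1); pose i2 := Ordinal (mod_lt i.+2).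
have odd_mod k : odd (k %% (2 * s)) = odd k.
  by rewrite {2}(divn_eq k (2 * s)) oddD !oddM andbF.
have i2E : (i2 : nat) = (i1.+1 %% (2 * s))%N.
  by rewrite /= -[in RHS]addn1 modnDml addn1.
case oi : (odd i).
  (* At an odd position the apex would be a sink, with an arc entering it from the preceding
     vertex. *)
  pose i0 := Ordinal (mod_lt (i.-1)).
  have := homf i0 i; rewrite -fi /= => H.
  suff : apex_arc (f i0) None by case: (f i0) => [[]|].
  apply: H; rewrite /ad_cycle_arc /= odd_mod.
  have ip : (0 < i)%N by case: (val i) oi.
  have := ltn_ord i => il.
  rewrite (modn_small (m := i.-1)); last by lia.
  by rewrite prednK // modn_small // eqxx; rewrite -(prednK ip) /= in oi; rewrite oi.
(* Now the apex is a source. Its arc puts [f i1] in $X$, whose only in-neighbour is the apex, so the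
   next source [f i2] is the apex again. *)
have arc1 : apex_arc (f i) (f i1).
  by apply: homf; rewrite /= /ad_cycle_arc oi eqxx.
have arc2 : apex_arc (f i2) (f i1).
  by apply: homf; rewrite /= /ad_cycle_arc i2E eqxx orbT -i2E /= odd_mod /= negbK oi.
have f2 : f i2 = f i.
  move: arc1 arc2; rewrite -fi.
  by case: (f i1) => [[]|] //= l; case: (f i2) => [[]|].
(* Injectivity would give $i+2\equiv i$ modulo $2s\ge4$; the cases are whether $i+2$ wraps
   around. *)
have /(congr1 val) /= := injf _ _ f2; have := ltn_ord i => il.
have [lt2|le2] := ltnP i.+2 (2 * s); first by rewrite modn_small //; lia.
have -> : i.+2 = (i.+2 - 2 * s + 2 * s)%N by lia.
by rewrite modnDr modn_small; lia.
Qed.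

End ApexGraph.

(** Lower bounds survive binary minima and hold for the default $+\infty$, so the complete case
    needs no separate argument. *)
Lemma sigma_Ore_star_ge (V : finType) (D : oriented_graph V) (R : realType)
    (b : nat) (c : R) : c <= b%:R ->
  (forall x y, x != y -> ~~ adj D x y -> (b <= dstar D x + dstar D y)%N) ->
  (c%:E <= sigma_Ore_star D R)%E.
Proof.
move=> cb H; apply: (big_ind (fun x => (c%:E <= x)%E)).
- exact: leey.
- by move=> x y cx cy; rewrite le_min cx cy.
- by move=> p /andP[p12 pn]; rewrite lee_fin (le_trans cb) // ler_nat H.
Qed.

Theorem theorem1p5 (R : realType) (s : nat) (hs : (2 <= s)%N) (C : R) (N : nat) :
  exists (n : nat) (V : finType) (D : oriented_graph V),
    [/\ (N <= n)%N /\ (2 * s %| n)%N,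
        #|V| = n,
        ((3 / 4 * n%:R + C)%:E <= sigma_Ore_star D R)%E,
        ((if s == 2%N then 3 / 4 * n%:R + 3 / 4 * (alpha D)%:R - 2
          else 3 / 4 * n%:R + 1 / 4 * (alpha D)%:R - 3 / 2)%:E
         <= sigma_Ore_star D R)%E
      & ~ has_factor (ad_cycle s) D].
Proof.
(* The factor $s$ makes $2s$ divide $n=12k$; the size of [K] ensures $n\ge N$, $C\le k$ and
   $k\ge1$. *)
pose K := (N + Num.bound `|C| + 1)%N; pose k := (s * K)%N.
have K_k : (K <= k)%N by rewrite leq_pmull; lia.
have C_k : C <= k%:R.
  rewrite (le_trans (ler_norm C)) // (le_trans (ltW (archi_boundP (normr_ge0 C)))) //.
  by rewrite ler_nat (leq_trans _ K_k) // /K -addnA addnCA leq_addr.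
have k_gt0 : (0 < k)%N by lia.
have k_ge1 : (1 : R) <= k%:R by rewrite ler1n.
(* Here $|X|=4k$ and $|Z|=8k-1$, so the two degree sums are at least $16k-2$ and $12k-1$; the latter
   is the smaller. *)
pose D := apex_graph (4 * k) (4 * k - 1).
have pairD x y : x != y -> ~~ adj D x y ->
    (12 * k - 1 <= dstar D x + dstar D y)%N.
  by move=> xy nxy; apply: leq_trans (apex_Ore_pair _ _ _ _ xy nxy); lia.
have aD : (alpha D)%:R <= 4 * k%:R :> R.
  by rewrite -natrM ler_nat alpha_apex //; lia.
have bE : (12 * k - 1)%:R = 12 * k%:R - 1 :> R by rewrite natrB ?natrM //; lia.
exists (12 * k)%N, _, D; split.
- split; first by lia.
  by rewrite /k mulnA dvdn_mulr // dvdn_mul.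
- by rewrite card_apex_graph; lia.
- by apply: sigma_Ore_star_ge pairD; rewrite bE natrM; lra.
(* With $\alpha(D)\le4k$ the targets are at most $12k-2$ and $10k-3/2$. *)
- by apply: sigma_Ore_star_ge pairD; rewrite bE natrM; case: ifP => _; lra.
- exact: apex_no_factor.
Qed.
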